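(* Let $\mathbb{F}$ be a field, let $(P,\cdot,[-,-])$ and $(P',\ast,[-,-]')$ be Poisson algebras over $\mathbb{F}$, and let $\mathfrak{p}(P;\sigma,s;\mu,\lambda,t)$ and $\mathfrak{p}(P';\sigma',s';\mu',\lambda',t')$ be Poisson affgebras of the form described in the context. An affine map $$\varphi\colon \mathfrak{p}(P;\sigma,s;\mu,\lambda,t)\to\mathfrak{p}(P';\sigma',s';\mu',\lambda',t')$$ is a morphism of Poisson affgebras if and only if there exist a Poisson algebra morphism $\psi\colon P\to P'$ and a point $q'\in P'$ such that, for all $a\in P$, the following conditions hold: \begin{align*} &\psi(s)+q'=(q')^2+q'\sigma'+\sigma'q'+s',\\ &\psi(\sigma a)=q'\ast\psi(a)+\sigma'\psi(a),\\ &\psi(a\sigma)=\psi(a)\ast q'+\psi(a)\sigma',\\ &\psi(t)+q'=(\mu'+\lambda')(q')+t',\\ &\psi(\mu(a))=(\mu'+\mathrm{ad}'_{q'})(\psi(a)),\\ &\psi(\lambda(a))=(\lambda'-\mathrm{ad}'_{q'})(\psi(a)). \end{align*}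
   Context: **Poisson algebra.** A vector space $P$ over $\mathbb{F}$ with a Lie bracket $[-,-]$ and an associative bilinear product (written by juxtaposition or $\cdot$, $\ast$; not assumed commutative or unital) with $[xy,z]=x[y,z]+[x,z]y$ for all $x,y,z$. A morphism of Poisson algebras is a linear map preserving both the product and the bracket. In $P'$, $(q')^2=q'\ast q'$ and $\mathrm{ad}'_{q'}$ denotes the linear map $x\mapsto [x,q']'$. **Homothetic datum.** A double operator $\sigma$ on an associative algebra $A$ is a pair $(\overleftarrow{\sigma},\overrightarrow{\sigma})$ of linear endomorphisms, written $a\sigma=\overleftarrow{\sigma}(a)$, $\sigma a=\overrightarrow{\sigma}(a)$. It is a double homothetism if $\sigma(ab)=(\sigma a)b$, $(ab)\sigma=a(b\sigma)$, $a(\sigma b)=(a\sigma)b$ and $\sigma(a\sigma)=(\sigma a)\sigma$ for all $a,b\in A$. A homothetic datum is a pair $(\sigma,s)$ with $\sigma$ a double homothetism and $s\in A$ such that $\sigma s=s\sigma$, $(a\sigma)\sigma=a\sigma+as$ and $\sigma(\sigma a)=\sigma a+sa$ for all $a\in A$. **The Poisson affgebra $\mathfrak{p}(P;\sigma,s;\mu,\lambda,t)$.** Here $(\sigma,s)$ is a homothetic datum on the associative algebra $(P,\cdot)$, $t\in P$, and $\lambda,\mu\colon P\to P$ are derivations of $(P,\cdot)$ such that $\lambda([a,b])=[\lambda(a),b]-[a,\mu(b)]$ for all $a,b\in P$. It is the vector space $P$ viewed as an affine space (heap operation $\langle a,b,c\rangle=a-b+c$, and $\alpha\triangleright_a b=(1-\alpha)a+\alpha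 b$), with the associative bi-affine product $a\bullet b=ab+a\sigma+\sigma b+s$ and the affine Poisson bracket $\{a,b\}=[a,b]+\mu(a)+\lambda(b)+t$. **Affine maps and morphisms.** A map $\varphi\colon P\to P'$ between vector spaces viewed as affine spaces is affine if it preserves $\langle-,-,-\rangle$ and $\varphi(\alpha\triangleright_a b)=\alpha\triangleright_{\varphi(a)}\varphi(b)$; equivalently it is a linear map plus a constant. A morphism of Poisson affgebras is an affine map $\varphi$ with $\varphi(a\bullet b)=\varphi(a)\bullet'\varphi(b)$ and $\varphi(\{a,b\})=\{\varphi(a),\varphi(b)\}'$ for all $a,b$.
   Formalization: The formal statement adds to the conditions on ψ and q' that φ(a) = ψ(a) + q' for all a; without this link the ''if'' direction is false (all structure zero on P = P' = F, φ(x) = x + 1, ψ = id, q' = 0). *)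

(* Defs.v *)
From HB Require Import structures.
From mathcomp Require Import all_boot all_algebra.

Set Implicit Arguments.
Unset Strict Implicit.
Unset Printing Implicit Defensive.

Import GRing.Theory.
Local Open Scope ring_scope.

(* Both products are taken bilinear on a bare lmodType, because the library's
   algebra structures are unital. The bracket is alternating ([x, x] = 0), which
   is the definition of a Lie bracket over a field of any characteristic. *)
HB.mixin Record Lmodule_isPoisson (F : fieldType) P of GRing.Lmodule F P := {
  pmul : P -> P -> P;
  pmul_linearl : forall y, linear (pmul^~ y);
  pmul_linearr : forall x, linear (pmul x);
  pmulA : associative pmul;
  lie : P -> P -> P;
  lie_linearl : forall y, linear (lie^~ y);
  lie_linearr : forall x, linear (lie x);
  liexx : forall x, lie x x = 0;
  lie_jacobi : forall x y z,
    lie x (lie y z) + lie y (lie z x) + lie z (lie x y) = 0;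
  lie_leibniz : forall x y z,
    lie (pmul x y) z = pmul x (lie y z) + pmul (lie x z) y
}.

#[short(type="poissonAlgType")]
HB.structure Definition PoissonAlgebra (F : fieldType) :=
  { P of Lmodule_isPoisson F P & GRing.Lmodule F P }.

Notation "x ** y" := (pmul x y) (at level 40, left associativity) : ring_scope.

Definition poisson_morphism (F : fieldType) (P P' : poissonAlgType F)
    (psi : {linear P -> P'}) : Prop :=
  (forall x y, psi (x ** y) = psi x ** psi y) /\
  (forall x y, psi (lie x y) = lie (psi x) (psi y)).

(* ad_q is bracketing with q on the right, x |-> [x, q]. *)
Definition ad (F : fieldType) (P : poissonAlgType F) (q : P) : P -> P :=
  fun x => lie x q.

(* [ract sigma a] is a sigma and [lact sigma a] is sigma a. *)
Record double_operator (F : fieldType) (P : lmodType F) := DoubleOperator {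
  ract : {linear P -> P};
  lact : {linear P -> P}
}.

Definition double_homothetism (F : fieldType) (P : poissonAlgType F)
    (sigma : double_operator P) : Prop :=
  [/\ forall a b, lact sigma (a ** b) = lact sigma a ** b,
      forall a b, ract sigma (a ** b) = a ** ract sigma b,
      forall a b, a ** lact sigma b = ract sigma a ** b
    & forall a, lact sigma (ract sigma a) = ract sigma (lact sigma a)].

Definition homothetic_datum (F : fieldType) (P : poissonAlgType F)
    (sigma : double_operator P) (s : P) : Prop :=
  [/\ double_homothetism sigma,
      lact sigma s = ract sigma s,
      forall a, ract sigma (ract sigma a) = ract sigma a + a ** s
    & forall a, lact sigma (lact sigma a) = lact sigma a + s ** a].

Definition derivation (F : fieldType) (P : poissonAlgType F)
    (d : {linear P -> P}) : Prop :=
  forall a b, d (a ** b) = d a ** b + a ** d b.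

(* The conditions on (sigma, s; mu, lambda, t) under which p(P; sigma, s; mu,
   lambda, t) is formed; the element t is unconstrained. *)
Definition paff_datum (F : fieldType) (P : poissonAlgType F)
    (sigma : double_operator P) (s : P) (mu lambda : {linear P -> P}) : Prop :=
  [/\ homothetic_datum sigma s,
      derivation mu,
      derivation lambda
    & forall a b, lambda (lie a b) = lie (lambda a) b - lie a (mu b)].

Definition heap (F : fieldType) (P : lmodType F) (a b c : P) : P := a - b + c.

(* alpha |>_a b *)
Definition aff_act (F : fieldType) (P : lmodType F) (alpha : F) (a b : P) : P :=
  (1 - alpha) *: a + alpha *: b.

Definition affine_map (F : fieldType) (P P' : lmodType F)
    (phi : P -> P') : Prop :=
  (forall a b c, phi (heap a b c) = heap (phi a) (phi b) (phi c)) /\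
  (forall alpha a b, phi (aff_act alpha a b) = aff_act alpha (phi a) (phi b)).

(* The two operations of a Poisson affgebra whose affine space is a vector
   space P. *)
Record affgebra_ops (P : Type) := AffgebraOps {
  aff_mul : P -> P -> P;
  aff_bracket : P -> P -> P
}.

(* p(P; sigma, s; mu, lambda, t) *)
Definition paff (F : fieldType) (P : poissonAlgType F)
    (sigma : double_operator P) (s : P) (mu lambda : {linear P -> P}) (t : P) :
    affgebra_ops P :=
  {| aff_mul := fun a b => a ** b + ract sigma a + lact sigma b + s;
     aff_bracket := fun a b => lie a b + mu a + lambda b + t |}.

Definition affgebra_morphism (F : fieldType) (P P' : lmodType F)
    (A : affgebra_ops P) (A' : affgebra_ops P') (phi : P -> P') : Prop :=
  [/\ affine_map phi,
      forall a b, phi (aff_mul A a b) = aff_mul A' (phi a) (phi b)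
    & forall a b, phi (aff_bracket A a b) = aff_bracket A' (phi a) (phi b)].

(* Main.v *)
(* An affine map is phi = psi + q' with q' = phi 0 and psi linear. Substituting
   this, each of the two morphism conditions becomes an identity between two
   expressions of the form B a b + L a + M b + c with B bilinear and L, M linear;
   setting a = 0 or b = 0 shows that such an identity holds exactly when it holds
   for each of the four terms separately. *)
Require Import Defs.
From HB Require Import structures.
From mathcomp Require Import all_boot all_algebra.

Import GRing.Theory.
Local Open Scope ring_scope.

Lemma linear_fun0 {F : fieldType} {U V : lmodType F} {f : U -> V} :
  linear f -> f 0 = 0.
Proof. by move=> fL; have := fL (-1) 0 0; rewrite !scaleN1r oppr0 addr0 addNr. Qed.

Lemma linear_funD {F : fieldType} {U V : lmodType F} {f : U -> V} :
  linear f -> forall x y, f (x + y) = f x + f y.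
Proof. by move=> fL x y; have := fL 1 x y; rewrite !scale1r. Qed.

Section Bilinear.

Context {F : fieldType} {U V : lmodType F}.

(** Kept as a predicate on plain functions, in the same form as the linearity axioms of [pmul] and
    [lie]. *)
Definition bilinear_fun (B : U -> U -> V) : Prop :=
  (forall y, linear (B^~ y)) /\ (forall x, linear (B x)).

Lemma bilinear_fun0l {B} (hB : bilinear_fun B) y : B 0 y = 0.
Proof. exact: (linear_fun0 (hB.1 y)). Qed.

Lemma bilinear_fun0r {B} (hB : bilinear_fun B) x : B x 0 = 0.
Proof. exact: (linear_fun0 (hB.2 x)). Qed.

Lemma bilinear_funDl {B} (hB : bilinear_fun B) x1 x2 y :
  B (x1 + x2) y = B x1 y + B x2 y.
Proof. exact: (linear_funD (hB.1 y)). Qed.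

Lemma bilinear_funDr {B} (hB : bilinear_fun B) x y1 y2 :
  B x (y1 + y2) = B x y1 + B x y2.
Proof. exact: (linear_funD (hB.2 x)). Qed.

(** Moving the origin to [q] leaves [B] alone; the cross terms [B x q] and [B q y] join the linear
    parts and [B q q] joins the constant. *)
Lemma biaffine_shift (B : U -> U -> V) (R L : {linear U -> V}) c q x y :
  bilinear_fun B ->
  B (x + q) (y + q) + R (x + q) + L (y + q) + c
  = B x y + (B x q + R x) + (B q y + L y) + (B q q + R q + L q + c).
Proof.
move=> hB; rewrite (bilinear_funDl hB) !(bilinear_funDr hB) !raddfD /= !addrA.
by rewrite [LHS](ACl (1*2*5*3*7*4*6*8*9)).
Qed.

(** Formulated for plain functions vanishing at zero, so that composites such as [psi (B a b)] can
    be used without bundling. *)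
Lemma biaffine_inj (B B' : U -> U -> V) (L L' M M' : U -> V) (c c' : V) :
    (forall x, B 0 x = 0 /\ B x 0 = 0) -> (forall x, B' 0 x = 0 /\ B' x 0 = 0) ->
    L 0 = 0 -> L' 0 = 0 -> M 0 = 0 -> M' 0 = 0 ->
  (forall a b, B a b + L a + M b + c = B' a b + L' a + M' b + c') <->
  [/\ B =2 B', L =1 L', M =1 M' & c = c'].
Proof.
move=> hB hB' L0 L'0 M0 M'0; split=> [E|[EB EL EM Ec] a b]; last first.
  by rewrite EB EL EM Ec.
have Ec : c = c'.
  by have := E 0 0; rewrite L0 L'0 M0 M'0 (hB 0).1 (hB' 0).1 !add0r.
have EL : L =1 L'.
  move=> a; have := E a 0.
  by rewrite M0 M'0 (hB a).2 (hB' a).2 !add0r !addr0 Ec => /addIr.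
have EM : M =1 M'.
  move=> b; have := E 0 b.
  by rewrite L0 L'0 (hB b).1 (hB' b).1 !add0r Ec => /addIr.
by split=> // a b; have := E a b; rewrite EL EM Ec => /addIr/addIr/addIr.
Qed.

End Bilinear.

(** Treats product and bracket at once: [B] will be [pmul] with [ract], [lact], [s], or [lie] with
    [mu], [lambda], [t]. *)
Lemma biaffine_morphism {F : fieldType} {U V : lmodType F}
    {B : U -> U -> U} {B' : V -> V -> V} (R L : {linear U -> U})
    (R' L' : {linear V -> V}) (c : U) (c' : V) (psi : {linear U -> V}) (q : V) :
    bilinear_fun B -> bilinear_fun B' ->
  (forall a b, psi (B a b + R a + L b + c) + q
     = B' (psi a + q) (psi b + q) + R' (psi a + q) + L' (psi b + q) + c') <->
  [/\ forall a b, psi (B a b) = B' (psi a) (psi b),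
      forall a, psi (R a) = B' (psi a) q + R' (psi a),
      forall b, psi (L b) = B' q (psi b) + L' (psi b)
    & psi c + q = B' q q + R' q + L' q + c'].
Proof.
move=> hB hB'.
apply: iff_trans (biaffine_inj (fun a b => psi (B a b))
    (fun a b => B' (psi a) (psi b))
    (fun a => psi (R a)) (fun a => B' (psi a) q + R' (psi a))
    (fun b => psi (L b)) (fun b => B' q (psi b) + L' (psi b)) _ _ _ _ _ _ _ _).
(* Once the right side is shifted by [q], the two identities differ only in bracketing; the [q] on
   the left belongs to the constant. *)
- split=> E a b; have := E a b; rewrite biaffine_shift // !raddfD /= -!addrA => E'.
    exact: E'.
  exact: E'.
- by move=> x; rewrite (bilinear_fun0l hB) (bilinear_fun0r hB) raddf0.
- by move=> x; rewrite raddf0 (bilinear_fun0l hB') (bilinear_fun0r hB').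
- by rewrite !raddf0.
- by rewrite /= !raddf0 (bilinear_fun0l hB') addr0.
- by rewrite !raddf0.
- by rewrite /= !raddf0 (bilinear_fun0r hB') addr0.
Qed.

(** Taking 0 as the middle point of the heap gives additivity up to [phi 0], and taking 0 as the
    base point of the action gives homogeneity. *)
Lemma affine_map_linear {F : fieldType} {U V : lmodType F} {phi : U -> V} :
  affine_map phi -> linear (fun a => phi a - phi 0).
Proof.
case=> phiH phiA k x y.
have phiD u v : phi (u + v) = phi u - phi 0 + phi v.
  by have := phiH u 0 v; rewrite /heap subr0.
have phiZ u : phi (k *: u) = (1 - k) *: phi 0 + k *: phi u.
  by have := phiA k 0 u; rewrite /aff_act scaler0 add0r.
rewrite phiD phiZ scalerBl scale1r scalerBr !addrA; congr (_ + _ - _).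
by rewrite [LHS](ACl (3*2*(1*4))) /= subrr addr0.
Qed.

Section PoissonBracket.

Context {F : fieldType} {P : poissonAlgType F}.

Lemma pmul_bilinear : bilinear_fun (@pmul F P).
Proof. by split; [exact: pmul_linearl | exact: pmul_linearr]. Qed.

Lemma lie_bilinear : bilinear_fun (@lie F P).
Proof. by split; [exact: lie_linearl | exact: lie_linearr]. Qed.

(** Polarisation of [liexx] at [x + y]. *)
Lemma lieC (x y : P) : lie x y = - lie y x.
Proof.
have := liexx (x + y); have hl := lie_bilinear.
rewrite (bilinear_funDl hl) !(bilinear_funDr hl) !liexx add0r addr0.
by move/eqP; rewrite addr_eq0 => /eqP.
Qed.

End PoissonBracket.

Theorem theorem4p8 (F : fieldType) (P P' : poissonAlgType F)
    (sigma : double_operator P) (s : P) (mu lambda : {linear P -> P}) (t : P)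
    (sigma' : double_operator P') (s' : P') (mu' lambda' : {linear P' -> P'})
    (t' : P')
    (hD : paff_datum sigma s mu lambda)
    (hD' : paff_datum sigma' s' mu' lambda')
    (phi : P -> P') (hphi : affine_map phi) :
  affgebra_morphism (paff sigma s mu lambda t) (paff sigma' s' mu' lambda' t')
    phi
  <->
  exists (psi : {linear P -> P'}) (q' : P'),
    poisson_morphism psi /\
    (forall a : P, phi a = psi a + q') /\
    (forall a : P,
       psi s + q' = q' ** q' + ract sigma' q' + lact sigma' q' + s' /\
       psi (lact sigma a) = q' ** psi a + lact sigma' (psi a) /\
       psi (ract sigma a) = psi a ** q' + ract sigma' (psi a) /\
       psi t + q' = (mu' \+ lambda') q' + t' /\
       psi (mu a) = (mu' \+ ad q') (psi a) /\
       psi (lambda a) = (lambda' \- ad q') (psi a)).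
Proof.
have mulE (psi : {linear P -> P'}) q' :=
  biaffine_morphism (ract sigma) (lact sigma) (ract sigma') (lact sigma')
    s s' psi q' pmul_bilinear pmul_bilinear.
have lieE (psi : {linear P -> P'}) q' :=
  biaffine_morphism mu lambda mu' lambda' t t' psi q' lie_bilinear lie_bilinear.
split=> [[_ phiM phiL]|[psi [q' [[psiM psiL] [phiE H]]]]].
  pose f a := phi a - phi 0.
  pose fL := GRing.isLinear.Build F P P' *:%R f (affine_map_linear hphi).
  pose psi : {linear P -> P'} := HB.pack f fL.
  have phiE a : phi a = psi a + phi 0 by rewrite /psi /= /f subrK.
  have [|psiM hr hl hs] := (mulE psi (phi 0)).1.
    by move=> a b; rewrite -!phiE; exact: phiM.
  have [|psiL hmu hlam ht] := (lieE psi (phi 0)).1.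
    by move=> a b; rewrite -!phiE; exact: phiL.
  exists psi, (phi 0); split; first by [].
  split=> // a; split; first exact: hs.
  split; first exact: hl.
  split; first exact: hr.
  (* The constant term of the shifted bracket contains [lie q' q'], which vanishes. *)
  split; first by rewrite ht liexx add0r.
  (* In the [lambda] condition the shift puts [phi 0] on the left of the bracket; antisymmetry turns
     this into minus [ad]. *)
  by split; rewrite ?hmu ?hlam /= /ad addrC // lieC.
(* The conditions on [s] and [t] do not depend on the point, so they are read off at 0. *)
have [hs [_ [_ [ht _]]]] := H 0.
split=> // a b; rewrite /= !phiE.
  apply: (mulE psi q').2; split=> // {a b}a.
    by have [_ [_ []]] := H a.
  by have [_ []] := H a.
apply: (lieE psi q').2; split=> // [{b}a|{a}b|].
- by have [_ [_ [_ [_ [-> _]]]]] := H a; rewrite addrC.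
- by have [_ [_ [_ [_ [_ ->]]]]] := H b; rewrite [lie q' _]lieC addrC.
- by rewrite ht liexx add0r.
Qed.
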